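(* Let $D\subseteq\mathbb{R}^m$ and let $f:\mathbb{R}^n\times D\to\mathbb{R}^n$ satisfy the standing assumptions given in the context. Suppose that the system $\dot x(t)=f(x(t),d(t))$ on $\mathbb{R}^n$ is input-to-state exponentially stable (ISES) with some class $\mathcal{K}_\infty$ function $\alpha$ and constants $c=\lambda=1$, i.e. all solutions satisfy $$\|\phi(t,x,d(\cdot))\|\le\max\Big\{e^{-t}\|x\|,\ \alpha\Big(\sup_{0\le\tau\le t}\|d(\tau)\|\Big)\Big\}$$ for all $x\in\mathbb{R}^n$, all $d(\cdot)\in\mathcal{D}$ and all $t\ge 0$. Then there exists a homeomorphism $R:\mathbb{R}^m\to\mathbb{R}^m$ with $R(0)=0$ that is a diffeomorphism on $\mathbb{R}^m\setminus\{0\}$, such that the system transformed by $v=R(d)$, $$\dot y(t)=\bar f(y(t),v(t)),\qquad \bar f(y,v)=f(y,R^{-1}(v)),$$ satisfies the nonlinear $H_\infty$ estimate $$\int_0^t\|\bar\phi(s,x,v(\cdot))\|^2\,ds\le\|x\|^2+\int_0^t\|v(s)\|^2\,ds$$ for all $x\in\mathbb{R}^n$, all inputs $v(\cdot)$ and all $t\ge 0$, where $\bar\phi(\cdot,x,v(\cdot))$ denotes any solution of the transformed system with initial value $x$ at time $0$.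
   Context: Throughout, $\|\cdot\|$ is the Euclidean norm and ''smooth'' means $C^\infty$; ''diffeomorphism on $\mathbb{R}^m\setminus\{0\}$'' means that the restrictions of $R$ and $R^{-1}$ to $\mathbb{R}^m\setminus\{0\}$ are both smooth. Standing assumptions: $D\subseteq\mathbb{R}^m$; $f:\mathbb{R}^n\times D\to\mathbb{R}^n$ is continuous and, for $x\neq 0$, locally Lipschitz continuous in $x$, where the local Lipschitz constants can be chosen uniformly in $d\in D$. $\mathcal{D}$ is the set of measurable, locally essentially bounded functions $d:\mathbb{R}\to D$; suprema of $\|d(\cdot)\|$ over time intervals are understood as essential suprema. For $x\in\mathbb{R}^n$ and $d(\cdot)\in\mathcal{D}$, $\phi(t,x,d(\cdot))$ denotes any maximal solution (possibly non-unique) for $t\ge 0$ of $\dot x(t)=f(x(t),d(t))$ with initial value $x$ at time $0$. The ISES hypothesis includes that solutions exist for all $t\ge 0$. The function $\bar f$ is defined on $\mathbb{R}^n\times R(D)$, and the inputs $v(\cdot)$ of the transformed system are the measurable, locally essentially bounded functions $v:\mathbb{R}\to R(D)$. A function $\alpha:[0,\infty)\to[0,\infty)$ is of class $\mathcal{K}_\infty$ if it is continuous, strictly increasing, unbounded and $\alpha(0)=0$.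
   Formalization: The formal theorem additionally assumes that f is bounded on bounded subsets of R^n × D (automatic for closed D; for arbitrary D the claim as stated fails), and it takes measurable inputs to be Borel measurable, which changes them only on null sets. *)

(* Defs.v *)
From HB Require Import structures.
From mathcomp Require Import all_boot all_order all_algebra.
From mathcomp Require Import all_classical all_reals all_analysis.
From mathcomp Require Import ess_sup_inf.

Set Implicit Arguments.
Unset Strict Implicit.
Unset Printing Implicit Defensive.

Import Order.TTheory GRing.Theory Num.Theory.
Import numFieldNormedType.Exports.

Local Open Scope classical_set_scope.
Local Open Scope ring_scope.

(* Euclidean norm; the canonical norm of 'rV[R]_n is the (equivalent) sup
   norm, so that topological notions can be taken from the library. *)
Definition enorm (R : realType) (n : nat) (x : 'rV[R]_n) : R :=
  Num.sqrt (\sum_(i < n) x 0 i ^+ 2).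

(* Functions [0, oo[ -> [0, oo[ are represented by total functions on R, whose
   values on negative numbers are irrelevant. *)
Definition class_Kinfty (R : realType) (alpha : R -> R) : Prop :=
  [/\ {within `[0, +oo[, continuous alpha},
      {in `[0, +oo[ &, {homo alpha : r s / r < s}},
      alpha 0 = 0
    & forall M : R, exists2 r : R, 0 <= r & M < alpha r].

Definition iter_partial (R : realType) (m p : nat) (g : 'rV[R]_m -> 'rV[R]_p)
    (s : seq 'I_m) : 'rV[R]_m -> 'rV[R]_p :=
  foldr (fun i h => 'D_(delta_mx 0 i) h) g s.

(* For open U: g is of class C^oo on U, i.e. its partial derivatives of all
   orders exist and are continuous on U. *)
Definition smooth_on (R : realType) (m p : nat) (U : set 'rV[R]_m)
    (g : 'rV[R]_m -> 'rV[R]_p) : Prop :=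
  forall (s : seq 'I_m) (x : 'rV[R]_m), U x ->
    {for x, continuous (iter_partial g s)} /\
    (forall i : 'I_m, derivable (iter_partial g s) x (delta_mx 0 i)).

(* Only the values f x d with D d matter. *)
Definition standing_assumptions (R : realType) (n m : nat) (D : set 'rV[R]_m)
    (f : 'rV[R]_n -> 'rV[R]_m -> 'rV[R]_n) : Prop :=
  {within [set z : 'rV[R]_n * 'rV[R]_m | D z.2],
    continuous (fun z => f z.1 z.2)} /\
  (forall x : 'rV[R]_n, x != 0 ->
    exists (U : set 'rV[R]_n) (L : R), nbhs x U /\
      forall y z d, U y -> U z -> D d ->
        enorm (f y d - f z d) <= L * enorm (y - z)).

(* f is bounded on bounded subsets of R^n x D; this is automatic for continuous
   f when D is closed. *)
Definition bounded_on_bounded_sets (R : realType) (n m : nat)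
    (D : set 'rV[R]_m) (f : 'rV[R]_n -> 'rV[R]_m -> 'rV[R]_n) : Prop :=
  forall r : R, exists C : R, forall x d, D d ->
    enorm x <= r -> enorm d <= r -> enorm (f x d) <= C.

(* Measurable, locally essentially bounded functions R -> D. Measurability is
   Borel measurability of the coordinates; every Lebesgue measurable function
   with values in D agrees almost everywhere with such a function. *)
Definition admissible_input (R : realType) (m : nat) (D : set 'rV[R]_m)
    (d : R -> 'rV[R]_m) : Prop :=
  [/\ forall t, D (d t),
      forall i, measurable_fun setT (fun t => d t 0 i)
    & forall a b : R, exists M : R,
        {ae lebesgue_measure, forall t, t \in `[a, b] -> enorm (d t) <= M}].

(* Essential supremum of ||d|| over [0, t]. Extending by 0 outside [0, t] is
   harmless as the norm is nonnegative; the value is finite for admissible d. *)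
Definition ess_sup_norm (R : realType) (m : nat) (d : R -> 'rV[R]_m) (t : R) : R :=
  fine (ess_sup lebesgue_measure
    ((fun s => (enorm (d s))%:E) \_ `[0, t])).

(* Caratheodory solution on [0, T[, 0 < T <= +oo, of x' = f(x, d(t)), x(0) = x0,
   as a solution of the integral equation x(t) = x0 + \int_0^t f(x(s), d(s)) ds. *)
Definition solution (R : realType) (n m : nat)
    (f : 'rV[R]_n -> 'rV[R]_m -> 'rV[R]_n) (x0 : 'rV[R]_n)
    (d : R -> 'rV[R]_m) (T : \bar R) (phi : R -> 'rV[R]_n) : Prop :=
  (0 < T)%E /\
  forall t : R, 0 <= t -> (t%:E < T)%E -> forall i : 'I_n,
    lebesgue_measure.-integrable `[0, t]
      (fun s => (f (phi s) (d s) 0 i)%:E) /\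
    phi t 0 i = x0 0 i + \int[lebesgue_measure]_(s in `[0, t]) f (phi s) (d s) 0 i.

Definition maximal_solution (R : realType) (n m : nat)
    (f : 'rV[R]_n -> 'rV[R]_m -> 'rV[R]_n) (x0 : 'rV[R]_n)
    (d : R -> 'rV[R]_m) (T : \bar R) (phi : R -> 'rV[R]_n) : Prop :=
  solution f x0 d T phi /\
  forall (T' : \bar R) (psi : R -> 'rV[R]_n),
    (T <= T')%E -> solution f x0 d T' psi ->
    (forall t : R, 0 <= t -> (t%:E < T)%E -> psi t = phi t) -> T' = T.

(* Solutions exist for all t >= 0: there is one on [0, +oo[, and no maximal
   solution stops earlier (solutions need not be unique). *)
Definition forward_complete (R : realType) (n m : nat) (D : set 'rV[R]_m)
    (f : 'rV[R]_n -> 'rV[R]_m -> 'rV[R]_n) : Prop :=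
  forall (x : 'rV[R]_n) (d : R -> 'rV[R]_m), admissible_input D d ->
    (exists phi, solution f x d +oo%E phi) /\
    (forall T phi, maximal_solution f x d T phi -> T = +oo%E).

Definition ISES (R : realType) (n m : nat) (D : set 'rV[R]_m)
    (f : 'rV[R]_n -> 'rV[R]_m -> 'rV[R]_n) (c lambda : R) (alpha : R -> R) : Prop :=
  forward_complete D f /\
  forall (x : 'rV[R]_n) (d : R -> 'rV[R]_m) (phi : R -> 'rV[R]_n),
    admissible_input D d -> maximal_solution f x d +oo%E phi ->
    forall t : R, 0 <= t ->
      enorm (phi t) <=
        Num.max (c * expR (- (lambda * t)) * enorm x) (alpha (ess_sup_norm d t)).

(* The integrands are nonnegative, so the integrals are always meaningful in
   the extended reals. *)
Definition Hinfty_estimate (R : realType) (n m : nat) (D : set 'rV[R]_m)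
    (f : 'rV[R]_n -> 'rV[R]_m -> 'rV[R]_n) : Prop :=
  forward_complete D f /\
  forall (x : 'rV[R]_n) (v : R -> 'rV[R]_m) (T : \bar R) (phi : R -> 'rV[R]_n),
    admissible_input D v -> solution f x v T phi ->
    forall t : R, 0 <= t -> (t%:E < T)%E ->
      (\int[lebesgue_measure]_(s in `[0%R, t]) (enorm (phi s) ^+ 2)%:E <=
       (enorm x ^+ 2)%:E +
       \int[lebesgue_measure]_(s in `[0%R, t]) (enorm (v s) ^+ 2)%:E)%E.

Definition homeomorphism_with_inverse (R : realType) (m : nat)
    (h g : 'rV[R]_m -> 'rV[R]_m) : Prop :=
  [/\ cancel h g, cancel g h, continuous h & continuous g].

(* Main.v *)
Require Import Defs.
From HB Require Import structures.
From mathcomp Require Import all_boot all_order all_algebra.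
From mathcomp Require Import all_classical all_reals all_analysis.
From mathcomp Require Import measurable_realfun ess_sup_inf ring lra.

Set Implicit Arguments.
Unset Strict Implicit.
Unset Printing Implicit Defensive.

Import Order.TTheory GRing.Theory Num.Theory.
Import numFieldNormedType.Exports.

Local Open Scope classical_set_scope.
Local Open Scope ring_scope.

(** The transformation is radial, [R(d) = rho(|d|) d / |d|], with [rho] a smooth
    increasing bijection of the open half-line that is chosen so large that
    [|y|^2] decays along the transformed system up to an error [|v|^2]:
    [2 <y, f (y, d)> + |y|^2 <= rho(|d|)^2] for all [y] and all [d] in [D].

    Such a [rho] exists for the following reason.  Feeding a constant input [d]
    into the stability estimate and letting time tend to zero gives
    [<y, f (y, d)> <= - |y|^2] wherever [|y| > alpha(|d|)]
    ([ISES_dissipation]), so there the left-hand side is negative whatever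
    [rho] is.  On the remaining pairs [|y| <= alpha(|d|)] the left-hand side is
    bounded while [d] stays bounded, because [f] is, and it tends to [0] with
    [d], because [y] does.  Hence [rho] only has to lie above a locally bounded
    function that vanishes at [0] ([gain_dominated]).

    Integrating the inequality along a solution gives the integral estimate
    ([dissipation_L2_gain]).  Solutions are only absolutely continuous, so the
    chain rule for [|y|^2] needs an argument: it is Fubini's theorem on the
    triangle [r <= s] ([primitive_square]).

    A smooth [rho] above arbitrary data is built from entire power series with
    nonnegative coefficients: these can grow as fast as desired at infinity
    ([entire_dominating]), and their inverses as slowly.  If [E1], [E2] are two
    such series, then [r |-> 1 / E2^-1 (1 / r)] tends to [0] as slowly as
    desired when [r] does, and [rho] is obtained by composing it with [E1]
    ([ray_iso_above]).

    Smoothness is proved by exhibiting classes of functions that are closed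
    under differentiation: one on the half-line ([smooth_pos]), and one on the
    punctured space, generated by the coordinates and the functions of
    [|x|^2] ([smooth_away0]).  Continuity of the radial maps at the origin
    comes from monotonicity alone. *)

(** * Smooth functions on the open half-line *)

(** The class of functions that are smooth on [0 < x].  The first constructor
    already yields all of them; the others record closure properties, so that
    [smooth_pos_deriv], proved by a single induction, replaces the Leibniz and
    Faa di Bruno formulas for higher derivatives.  Values at [x <= 0] are
    unconstrained. *)
Inductive smooth_pos (R : realType) : (R -> R) -> Prop :=
| smooth_pos_tower (d : nat -> R -> R) :
    (forall k (x : R), 0 < x -> is_derive x (1 : R) (d k) (d k.+1 x)) ->
    smooth_pos (d 0%N)
| smooth_posD (f g : R -> R) : smooth_pos f -> smooth_pos g ->
    smooth_pos (fun x => f x + g x)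
| smooth_posM (f g : R -> R) : smooth_pos f -> smooth_pos g ->
    smooth_pos (fun x => f x * g x)
| smooth_posV (f : R -> R) : (forall x : R, 0 < x -> 0 < f x) ->
    smooth_pos f -> smooth_pos (fun x => (f x)^-1)
| smooth_pos_comp (f g : R -> R) : (forall x : R, 0 < x -> 0 < g x) ->
    smooth_pos f -> smooth_pos g -> smooth_pos (fun x => f (g x))
| smooth_pos_inverse (f f' g : R -> R) :
    (forall x : R, 0 < x -> [/\ 0 < f x, g (f x) = x,
      is_derive x (1 : R) f (f' x) & 0 < f' x]) ->
    (forall y : R, 0 < y -> 0 < g y /\ f (g y) = y) ->
    smooth_pos f' -> smooth_pos g.

Lemma near_pos (R : realType) (x : R) : 0 < x -> \forall y \near x, 0 < y.
Proof. by move=> x0; exact: lt_nbhsr. Qed.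

Lemma smooth_pos_cst (R : realType) (c : R) : smooth_pos (fun=> c).
Proof.
exact: (@smooth_pos_tower R (fun k _ => if k is 0%N then c else 0)).
Qed.

Lemma smooth_pos_id (R : realType) : smooth_pos (fun x : R => x).
Proof.
apply: (@smooth_pos_tower R
  (fun k x => match k with 0%N => x | 1%N => 1 | _ => 0 end)).
by move=> [|[|k]] x _; [exact: is_derive_id|exact: is_derive_cst..].
Qed.

(** Each rule of differentiation expresses the derivative by operations under
    which the class is closed; for an inverse [g] of [f] it is
    [1 / f' (g y)]. *)
Lemma smooth_pos_deriv (R : realType) (f : R -> R) : smooth_pos f ->
  exists2 f', smooth_pos f' &
    forall x : R, 0 < x -> is_derive x (1 : R) f (f' x).
Proof.
elim=> {f}[d dd|f g fs [f' sf' df] gs [g' sg' dg]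
  |f g fs [f' sf' df] gs [g' sg' dg]|f f0 fs [f' sf' df]
  |f g g0 fs [f' sf' df] gs [g' sg' dg]|f f' g fP gP sf' _].
- exists (d 1%N) => [|x x0]; last exact: dd.
  exact: (@smooth_pos_tower R (fun k => d k.+1)).
- exists (fun x => f' x + g' x) => [|x x0]; first exact: smooth_posD.
  by have := df x x0; have := dg x x0 => *; exact: is_deriveD.
- exists (fun x => f x * g' x + g x * f' x) => [|x x0].
    by apply: smooth_posD; exact: smooth_posM.
  by have := df x x0; have := dg x x0 => *; exact: is_deriveM.
- exists (fun x => (-1 * ((f x)^-1 * (f x)^-1)) * f' x) => [|x x0].
    apply: smooth_posM => //; apply: smooth_posM; first exact: smooth_pos_cst.
    by apply: smooth_posM; exact: smooth_posV.
  have dfx := df x x0.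
  have -> : -1 * ((f x)^-1 * (f x)^-1) * f' x = - (f x) ^- 2 *: f' x.
    by rewrite /GRing.scale/= expr2 invfM mulN1r.
  by apply: is_deriveV; rewrite gt_eqF// f0.
- exists (fun x => f' (g x) * g' x) => [|x x0].
    by apply: smooth_posM => //; exact: smooth_pos_comp.
  have := df _ (g0 _ x0); have := dg x x0 => d1 d2.
  exact: is_derive1_comp.
- exists (fun y => (f' (g y))^-1) => [|y y0].
    apply: smooth_posV => [x /gP[gx0 _]|]; first by have [] := fP _ gx0.
    apply: smooth_pos_comp => // [x /gP[]//|].
    exact: (smooth_pos_inverse fP gP).
  have [gy0 gyK] := gP _ y0; have [_ _ dfy f'y] := fP _ gy0.
  rewrite -{1}gyK; apply: is_derive_inverse => //; last by rewrite gt_eqF.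
    by near=> z; have [|] := fP z; [near: z; exact: near_pos|].
  near=> z; have [|_ _ dz _] := fP z; first by near: z; exact: near_pos.
  apply/differentiable_continuous/derivable1_diffP; exact: ex_derive.
Unshelve. all: by end_near. Qed.

Lemma smooth_pos_continuous (R : realType) (f : R -> R) (x : R) :
  smooth_pos f -> 0 < x -> {for x, continuous f}.
Proof.
move=> /smooth_pos_deriv[f' _ df] /df dfx.
by apply/differentiable_continuous/derivable1_diffP; exact: ex_derive.
Qed.

(** * Smooth functions on the punctured space *)

Definition sqnorm (R : realType) (m : nat) (x : 'rV[R]_m) : R :=
  \sum_(i < m) x 0 i ^+ 2.

(** An algebra of functions that are smooth away from the origin: [|x|^2]
    rather than [|x|] is composed with functions on the half-line because its
    partial derivatives are coordinates. *)
Inductive smooth_away0 (R : realType) (m : nat) : ('rV[R]_m -> R) -> Prop :=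
| smooth_away0_cst c : smooth_away0 (fun=> c)
| smooth_away0_coord j : smooth_away0 (fun x => x 0 j)
| smooth_away0D (f g : 'rV[R]_m -> R) : smooth_away0 f -> smooth_away0 g ->
    smooth_away0 (fun x => f x + g x)
| smooth_away0M (f g : 'rV[R]_m -> R) : smooth_away0 f -> smooth_away0 g ->
    smooth_away0 (fun x => f x * g x)
| smooth_away0_radial (p : R -> R) : smooth_pos p ->
    smooth_away0 (fun x => p (sqnorm x)).

Lemma sqnorm_ge0 (R : realType) (m : nat) (x : 'rV[R]_m) : 0 <= sqnorm x.
Proof. by apply: sumr_ge0 => i _; rewrite sqr_ge0. Qed.

Lemma sqnorm_gt0 (R : realType) (m : nat) (x : 'rV[R]_m) :
  (0 < sqnorm x) = (x != 0).
Proof.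
rewrite lt0r sqnorm_ge0 andbT /sqnorm psumr_eq0; last first.
  by move=> i _; rewrite sqr_ge0.
congr (~~ _); apply/allP/eqP => [x0|-> i _]; last by rewrite mxE expr0n /=.
apply/rowP => i; rewrite mxE.
by have := x0 i (mem_index_enum i); rewrite sqrf_eq0 => /eqP.
Qed.

Lemma continuous_sqnorm (R : realType) (m : nat) : continuous (@sqnorm R m).
Proof.
apply: continuous_big => [|i _ x]; first exact: add_continuous.
by have c := @coord_continuous R 1 m 0 i x; exact: (cvgM c c).
Qed.

Lemma near_neq0 (R : realType) (m : nat) (x : 'rV[R]_m) :
  x != 0 -> \forall y \near x, y != 0.
Proof.
rewrite -sqnorm_gt0 => x0; near=> y; rewrite -sqnorm_gt0; near: y.
exact: (continuous_sqnorm (near_pos x0)).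
Unshelve. all: by end_near. Qed.

(** Turns a directional derivative into a derivative in one variable, to which
    the chain rule for real functions applies. *)
Lemma is_derive_line (R : realType) (m : nat) (f : 'rV[R]_m -> R) x v l :
  is_derive (0 : R) (1 : R) (fun t => f (x + t *: v)) l <-> is_derive x v f l.
Proof.
have E : (fun h : R => h^-1 *: ((f \o shift x) (h *: v) - f x)) =
   (fun h => h^-1 *: (((fun t => f (x + t *: v)) \o shift 0) (h *: (1 : R)) -
                      f (x + 0 *: v))).
  apply/funext => h /=.
  by rewrite scale0r !addr0 [h%:A]mulr1 [h *: v + x]addrC.
split=> -[D <-]; apply: DeriveDef.
- by rewrite /derivable E.
- by rewrite /derive E.
- by rewrite /derivable -E.
- by rewrite /derive -E.
Qed.

Lemma is_derive_coord (R : realType) (m : nat) (x v : 'rV[R]_m) j :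
  is_derive x v (fun y => y 0 j) (v 0 j).
Proof.
apply/is_derive_line; under eq_fun do rewrite !mxE.
by apply: is_derive_eq; rewrite scaler0 add0r /GRing.scale/= mul1r mulr1 add0r.
Qed.

Lemma is_derive_sqnorm (R : realType) (m : nat) (x v : 'rV[R]_m) :
  is_derive x v (@sqnorm R m) (\sum_(i < m) 2 * x 0 i * v 0 i).
Proof.
have -> : @sqnorm R m = \sum_(i < m) (fun y : 'rV[R]_m => y 0 i) ^+ 2.
  by apply/funext => y; rewrite fct_sumE.
apply: is_derive_sum => i.
have := is_derive_coord x v i => d.
by apply: is_derive_eq; rewrite /GRing.scale/= expr1.
Qed.

Lemma smooth_away0_deriv (R : realType) (m : nat) (f : 'rV[R]_m -> R) v :
  smooth_away0 f -> exists2 f', smooth_away0 f' &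
    forall x : 'rV[R]_m, x != 0 -> is_derive x v f (f' x).
Proof.
elim=> {f}[c|j|f g fs [f' sf' df] gs [g' sg' dg]
  |f g fs [f' sf' df] gs [g' sg' dg]
  |p /smooth_pos_deriv[p' sp' dp]].
- exists (fun=> 0) => [|x _]; first exact: smooth_away0_cst.
  exact: is_derive_cst.
- exists (fun=> v 0 j) => [|x _]; first exact: smooth_away0_cst.
  exact: is_derive_coord.
- exists (fun x => f' x + g' x) => [|x x0]; first exact: smooth_away0D.
  by have := df x x0; have := dg x x0 => *; exact: is_deriveD.
- exists (fun x => f x * g' x + g x * f' x) => [|x x0].
    by apply: smooth_away0D; exact: smooth_away0M.
  by have := df x x0; have := dg x x0 => *; exact: is_deriveM.
- exists (fun x => p' (sqnorm x) * \sum_(i < m) 2 * x 0 i * v 0 i) => [|x x0].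
    apply: smooth_away0M; first exact: smooth_away0_radial.
    elim: (index_enum _) => [|i s IHs].
      by under eq_fun do rewrite big_nil; exact: smooth_away0_cst.
    under eq_fun do rewrite big_cons.
    apply: smooth_away0D => //; apply: smooth_away0M (smooth_away0_cst _ _).
    by apply: smooth_away0M (smooth_away0_cst _ _) (smooth_away0_coord _ _).
  apply/is_derive_line.
  have d2 := (is_derive_line (@sqnorm R m) x v _).2 (is_derive_sqnorm x v).
  apply: (@is_derive1_comp R p (fun t => sqnorm (x + t *: v))).
  by rewrite scale0r addr0; apply: dp; rewrite sqnorm_gt0.
Qed.

Lemma smooth_away0_continuous (R : realType) (m : nat) (f : 'rV[R]_m -> R) x :
  smooth_away0 f -> x != 0 -> {for x, continuous f}.
Proof.
move=> + x0; elim=> {f}[c|j|f g _ fc _ gc|f g _ fc _ gc|p ps].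
- by move=> A; exact: cst_continuous.
- exact: coord_continuous.
- exact: (cvgD fc gc).
- exact: (cvgM fc gc).
- apply: (@continuous_comp _ _ _ (@sqnorm R m) p).
    exact: continuous_sqnorm.
  by apply: smooth_pos_continuous => //; rewrite sqnorm_gt0.
Qed.

Lemma cvg_row (R : realType) (p : nat) (T : Type) (F : set_system T)
    (f : T -> 'rV[R]_p) (l : 'rV[R]_p) : Filter F ->
  (forall k, f y 0 k @[y --> F] --> l 0 k) -> f y @[y --> F] --> l.
Proof.
move=> FF fl A [P Px PA].
suff : \forall y \near F, forall i j, P i j (f y i j).
  by apply: filterS => y; exact: PA.
apply: filter_forall => i; apply: filter_forall => j.
by have := Px i j; rewrite !(ord1 i) => /(fl j).
Qed.

(** By induction on the list of directions, each component of an iterated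
    partial derivative agrees off the origin with a function of the algebra. *)
Lemma smooth_on_away0 (R : realType) (m p : nat) (g : 'rV[R]_m -> 'rV[R]_p) :
  (forall k, exists2 f, smooth_away0 f & forall x, x != 0 -> g x 0 k = f x) ->
  smooth_on [set x | x != 0] g.
Proof.
move=> gs s.
have {gs} : forall k, exists2 f, smooth_away0 f &
    forall x, x != 0 -> iter_partial g s x 0 k = f x.
  elim: s => //= i s IHs k; have [f fs fE] := IHs k.
  have [f' fs' df] := smooth_away0_deriv (delta_mx 0 i) fs.
  exists f' => // x x0.
  have [D dE] : is_derive x (delta_mx 0 i)
      (fun y => iter_partial g s y 0 k) (f' x).
    apply: near_eq_is_derive (df x x0).
    by apply: filterS (near_neq0 x0) => y /fE.
  rewrite derive_mx ?mxE //; apply/derivable_mxP => r {D dE}l; rewrite ord1.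
  have [f2 fs2 fE2] := IHs l.
  have [f2' _ /(_ x x0) df2] := smooth_away0_deriv (delta_mx 0 i) fs2.
  apply: near_eq_derivable (@ex_derive _ _ _ _ _ _ _ df2).
  by apply: filterS (near_neq0 x0) => y /fE2.
move=> gs x /= x0; split.
  apply: (cvg_row (F := nbhs x)) => k; have [f fs fE] := gs k.
  have fc : f y @[y --> x] --> f x := smooth_away0_continuous fs x0.
  rewrite -fE // in fc; apply: cvg_trans fc.
  apply: (near_eq_cvg (F := nbhs x)).
  by apply: filterS (near_neq0 x0) => y /fE.
move=> i; apply/derivable_mxP => r k; rewrite ord1.
have [f fs fE] := gs k.
have [f' _ /(_ x x0) df] := smooth_away0_deriv (delta_mx 0 i) fs.
apply: near_eq_derivable (@ex_derive _ _ _ _ _ _ _ df).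
by apply: filterS (near_neq0 x0) => y /fE.
Unshelve. all: by end_near. Qed.

(** * Entire power series of arbitrarily fast growth *)

Definition entire (R : realType) (a : nat -> R) : Prop :=
  forall x, cvgn (pseries a x).

(** Since [n + 1 <= 2 ^ (n + 1)], the differentiated series at [x] is dominated
    by the absolutely convergent series at [2 (|x| + 1)]. *)
Lemma entire_diffs (R : realType) (a : nat -> R) :
  entire a -> entire (pseries_diffs a).
Proof.
move=> ea x; pose K : R := 2 * (`|x| + 1).
have x1 : 1 <= `|x| + 1 by rewrite lerDr.
have K0 : 0 <= K by rewrite mulr_ge0 // addr_ge0.
have cK : cvgn (pseries (fun i => `|a i|) K).
  apply: (is_cvg_pseries_inside_norm (ea (K + 1))).
  by rewrite !ger0_norm ?ltrDl ?addr_ge0.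
have cS : cvgn (series (fun i => `|a i.+1| * K ^+ i.+1)).
  have -> : series (fun i => `|a i.+1| * K ^+ i.+1) =
      (fun n => pseries (fun i => `|a i|) K n.+1 - `|a 0%N| * K ^+ 0).
    apply/funext => n; rewrite /pseries /series /= [in RHS]big_nat_recl //=.
    by rewrite addrAC subrr add0r.
  apply: is_cvgB; last exact: is_cvg_cst.
  move/cvg_ex: cK => [l]; rewrite -cvg_shiftS => cl.
  by apply/cvg_ex; exists l.
apply: normed_cvg; apply: series_le_cvg cS => [n|n|n] /=.
- exact: normr_ge0.
- by rewrite mulr_ge0 // exprn_ge0.
- rewrite /pseries_diffs /= !normrM normr_nat normrX mulrAC mulrC.
  rewrite ler_wpM2l // /K exprMn ler_pM ?exprn_ge0 //.
    by rewrite -natrX ler_nat ltnW // ltn_expl.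
  apply: (@le_trans _ _ ((`|x| + 1) ^+ n)).
    by rewrite lerXn2r // ?nnegrE ?addr_ge0 // lerDl.
  by rewrite exprS ler_peMl ?exprn_ge0 // addr_ge0.
Qed.

Definition entire_fun (R : realType) (a : nat -> R) (x : R) : R :=
  limn (pseries a x).

Lemma is_derive_entire (R : realType) (a : nat -> R) (x : R) :
  entire a ->
  is_derive x (1 : R) (entire_fun a) (entire_fun (pseries_diffs a) x).
Proof.
move=> ea; have K0 : 0 <= `|x| + 1 by rewrite addr_ge0.
apply: (@pseries_snd_diffs _ a (`|x| + 1)).
- exact: ea.
- exact: entire_diffs.
- by apply: entire_diffs; exact: entire_diffs.
- by rewrite [ltRHS]ger0_norm // ltrDl.
Qed.

Lemma smooth_pos_entire (R : realType) (a : nat -> R) :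
  entire a -> smooth_pos (entire_fun a).
Proof.
move=> ea; have eda k : entire (iter k (@pseries_diffs R) a).
  by elim: k => // k IHk; exact: entire_diffs.
apply: (@smooth_pos_tower R
  (fun k => entire_fun (iter k (@pseries_diffs R) a))).
by move=> k x _; exact: is_derive_entire.
Qed.

(** [N] is an inverse of the sequence [C], so it tends to infinity, but as
    slowly as [C] grows fast. *)
Lemma slow_index (C : nat -> nat) : (forall i, i <= C i)%N ->
  exists N : nat -> nat,
    [/\ forall j, (0 < N j)%N,
        forall j k, (0 < k)%N -> (j <= C k)%N -> (N j <= k)%N
      & forall K, exists J, forall j, (J <= j)%N -> (K <= N j)%N].
Proof.
move=> leC; have ex j : exists i, (0 < i)%N && (j <= C i)%N.
  by exists j.+1; rewrite /= (leq_trans (leqnSn j)) // leC.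
exists (fun j => ex_minn (ex j)); split.
- by move=> j; case: ex_minnP => i /andP[].
- by move=> j k k0 jk; case: ex_minnP => i _; apply; rewrite k0.
- move=> K; exists (\sum_(i < K) C i).+1 => j Kj.
  case: ex_minnP => i /andP[_ ji] _; rewrite leqNgt; apply/negP => iK.
  have := leq_trans Kj ji; rewrite ltnNge => /negP; apply.
  by rewrite (bigD1 (Ordinal iK)) //= leq_addr.
Qed.

(** The series is the sum of [(x / N j) ^ j] with [N] as in [slow_index]: the
    radius of convergence is infinite as [N] tends to infinity, and for
    [x >= k] each of the terms [j = 1, ..., C k] is at least [1]. *)
Lemma entire_dominating (R : realType) (C : nat -> nat) :
  exists a : nat -> R, [/\ entire a, forall j, 0 <= a j, a 0%N = 0, a 1%N = 1
    & forall k x, (0 < k)%N -> k%:R <= x -> (C k)%:R <= entire_fun a x].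
Proof.
have [N [N0 Nle Noo]] : exists N : nat -> nat,
    [/\ forall j, (0 < N j)%N,
        forall j k, (0 < k)%N -> (j <= maxn k (C k))%N -> (N j <= k)%N
      & forall K, exists J, forall j, (J <= j)%N -> (K <= N j)%N].
  by apply: slow_index => i; exact: leq_maxl.
pose a j : R := if j is 0%N then 0 else (N j)%:R^-1 ^+ j.
have a0 j : 0 <= a j by case: j => //= j; rewrite exprn_ge0.
have ea : entire a.
  move=> x; have [K xK] : exists K : nat, 2 * `|x| <= K%:R.
    by exists (Num.truncn (2 * `|x|)).+1; rewrite ltW // Num.Theory.truncnS_gt.
  have [J JN] := Noo K.
  have y0 : 0 <= 2 * `|x| by rewrite mulr_ge0.
  have B0 n : 0 <= (2 * `|x| + 1) ^+ n by rewrite exprn_ge0 // addr_ge0.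
  apply: normed_cvg.
  (* the constant also covers the finitely many terms with [j < J] *)
  apply: (@series_le_cvg _ _ (geometric ((2 * `|x| + 1) ^+ J) 2^-1))
    => [j|j|j|].
  - exact: normr_ge0.
  - by rewrite /= mulr_ge0 ?exprn_ge0.
  - case: j => [|j]; first by rewrite /= mul0r normr0 mulr_ge0 ?exprn_ge0.
    rewrite /a /= -exprMn normrX normrM gtr0_norm ?invr_gt0 ?ltr0n //.
    have r0 : 0 <= (N j.+1)%:R^-1 * `|x| by rewrite mulr_ge0.
    have [Jj|jJ] := leqP J j.+1.
      rewrite -[leLHS]mul1r ler_pM ?exprn_ge0 // ?exprn_ege1 ?lerDr //.
      rewrite lerXn2r ?nnegrE // ler_pdivrMl ?ltr0n // ler_pdivlMr //.
      by rewrite mulrC (le_trans xK) // ler_nat JN.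
    have -> : (N j.+1)%:R^-1 * `|x| = (N j.+1)%:R^-1 * (2 * `|x|) * 2^-1.
      by rewrite -mulrA (mulrC 2) mulfK.
    rewrite exprMn ler_pM ?exprn_ge0 ?mulr_ge0 //.
    apply: (@le_trans _ _ ((2 * `|x| + 1) ^+ j.+1)).
      rewrite lerXn2r ?nnegrE ?mulr_ge0 ?addr_ge0 //.
      rewrite ler_pdivrMl ?ltr0n // (@le_trans _ _ (2 * `|x| + 1)) ?lerDl //.
      by rewrite ler_peMl ?addr_ge0 // ler1n.
    by rewrite ler_weXn2l ?lerDr // ltnW.
  - by apply: is_cvg_geometric_series; rewrite ger0_norm // invf_lt1 // ltr1n.
exists a; split=> //.
  rewrite /a expr1; have /eqP -> : N 1%N == 1%N; last by rewrite invr1.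
  by rewrite eqn_leq N0 Nle // leq_max leqnn.
move=> k x k0 kx.
have kge0 : 0 <= x by exact: le_trans kx.
apply: (@le_trans _ _ (pseries a x (C k).+1)); last first.
  apply: nondecreasing_cvgn_le; last exact: ea.
  by apply: nondecreasing_series => i _ _; rewrite mulr_ge0 ?exprn_ge0.
rewrite /pseries /series /= big_nat_recl //= mul0r add0r.
rewrite -[leLHS]mulr1 mulr_natl -[X in _ *+ X]subn0 -sumr_const_nat.
apply: ler_sum_nat => j jC.
rewrite -exprMn exprn_ege1 // ler_pdivlMl ?ltr0n // mulr1.
apply: le_trans kx; rewrite ler_nat; apply: Nle => //.
by rewrite leq_max; apply/orP; right.
Qed.

(** * Smooth increasing bijections of the open half-line *)

(** A smooth increasing bijection [p] of the open half-line together with its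
    smooth inverse [q].  Such a [p] tends to [0] at [0] automatically. *)
Definition ray_iso (R : realType) (p q : R -> R) : Prop :=
  [/\ smooth_pos p, smooth_pos q,
      forall x, 0 < x -> 0 < p x /\ q (p x) = x,
      forall y, 0 < y -> 0 < q y /\ p (q y) = y
    & forall x y, 0 < x -> x < y -> p x < p y].

Lemma ray_iso_sym (R : realType) (p q : R -> R) : ray_iso p q -> ray_iso q p.
Proof.
move=> [sp sq pP qP p_lt]; split=> // x y x0 xy.
have y0 := lt_trans x0 xy.
have [[qx0 qxK] [qy0 qyK]] := (qP _ x0, qP _ y0).
rewrite ltNge; apply/negP; rewrite le_eqVlt.
move=> /predU1P[/(congr1 p)|/(p_lt _ _ qy0)].
  by rewrite qxK qyK => /eqP; rewrite gt_eqF.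
by rewrite qxK qyK ltNge ltW.
Qed.

Lemma ray_iso_comp (R : realType) (p q p' q' : R -> R) :
  ray_iso p q -> ray_iso p' q' ->
  ray_iso (fun x => p (p' x)) (fun x => q' (q x)).
Proof.
move=> [sp sq pP qP p_lt] [sp' sq' pP' qP' p'_lt]; split.
- by apply: smooth_pos_comp => // x /pP'[].
- by apply: smooth_pos_comp => // x /qP[].
- by move=> x /pP'[p'x p'K]; have [px pK] := pP _ p'x; rewrite pK.
- by move=> x /qP[qx qK]; have [q'x q'K] := qP' _ qx; rewrite q'K.
- move=> x y x0 xy; apply: p_lt; last exact: p'_lt.
  by have [] := pP' _ x0.
Qed.

(** Exchanges the behaviours at [0] and at infinity. *)
Lemma ray_iso_recip (R : realType) (p q : R -> R) : ray_iso p q ->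
  ray_iso (fun x => (p x^-1)^-1) (fun x => (q x^-1)^-1).
Proof.
move=> [sp sq pP qP p_lt]; have inv_pos x : 0 < x -> 0 < x^-1 :> R.
  by rewrite invr_gt0.
have sinv (f : R -> R) : smooth_pos f -> (forall x, 0 < x -> 0 < f x) ->
    smooth_pos (fun x => (f x^-1)^-1).
  move=> sf f0; apply: smooth_posV => [x x0|]; first by rewrite f0 ?inv_pos.
  apply: (smooth_pos_comp inv_pos sf); apply: smooth_posV => //.
  exact: smooth_pos_id.
split.
- by apply: sinv => // x /pP[].
- by apply: sinv => // x /qP[].
- by move=> x /inv_pos/pP[px pK]; rewrite invr_gt0 invrK pK invrK.
- by move=> x /inv_pos/qP[qx qK]; rewrite invr_gt0 invrK qK invrK.
- move=> x y x0 xy; have y0 := lt_trans x0 xy.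
  have [[px _] [py _]] := (pP _ (inv_pos _ x0), pP _ (inv_pos _ y0)).
  by rewrite ltf_pV2 ?posrE // p_lt ?inv_pos // ltf_pV2 ?posrE.
Qed.

Lemma ray_iso_scale (R : realType) (c : R) : 0 < c ->
  ray_iso (fun x => c * x) (fun x => c^-1 * x).
Proof.
move=> c0; have sm (b : R) : smooth_pos (fun x => b * x).
  by apply: smooth_posM (smooth_pos_cst b) (smooth_pos_id R).
split=> // [x x0|x x0|x y x0 xy].
- by rewrite mulr_gt0 // mulKf // gt_eqF.
- by rewrite mulr_gt0 ?invr_gt0 // mulVKf // gt_eqF.
- by rewrite ltr_pM2l.
Qed.

(** The bound [x <= p x] makes it possible to dominate by a composition
    in [ray_iso_above]. *)
Lemma ray_iso_dominating (R : realType) (C : nat -> nat) :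
  exists p q : R -> R, [/\ ray_iso p q, forall x, 0 < x -> x <= p x
    & forall k x, (0 < k)%N -> k%:R <= x -> (C k)%:R <= p x].
Proof.
have [a [ea a_ge0 a0 a1 a_dom]] := entire_dominating R C.
pose E := entire_fun a.
have E_incr x y : 0 <= x -> x <= y -> y - x <= E y - E x.
  move=> x0 xy; rewrite /E /entire_fun -lim_seriesB; [|exact: ea..].
  have -> : y - x =
      series ((fun n => a n * y ^+ n) - (fun n => a n * x ^+ n)) 2%N.
    rewrite /series /= !big_nat_recr //= big_nil !fctE a0 a1.
    by rewrite !mul0r !mul1r !expr1 subrr !add0r.
  apply: nondecreasing_cvgn_le; last by apply: is_cvg_seriesB; exact: ea.
  apply: nondecreasing_series => n _ _ /=; rewrite !fctE subr_ge0.
  by rewrite ler_wpM2l // lerXn2r // nnegrE // (le_trans x0).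
have E0 : E 0 = 0.
  rewrite /E /entire_fun; have -> : pseries a 0 = fun=> 0; last exact: lim_cst.
  apply/funext => n; rewrite /pseries /series /= big1 // => -[|i] _.
    by rewrite a0 mul0r.
  by rewrite exprS mul0r mulr0.
have E_ge x : 0 <= x -> x <= E x.
  by move=> x0; have := E_incr 0 x (lexx _) x0; rewrite E0 !subr0.
have dE x : is_derive x (1 : R) E (entire_fun (pseries_diffs a) x).
  exact: is_derive_entire.
have E_lt x y : 0 < x -> x < y -> E x < E y.
  move=> x0 xy; rewrite -subr_gt0.
  by apply: lt_le_trans (E_incr _ _ (ltW x0) (ltW xy)); rewrite subr_gt0.
have E_surj y : exists x, 0 < y -> 0 < x /\ E x = y.
  have [y0|y0] := ltP 0 y; last by exists 0.
  have [||x] := @IVT R E 0 y y (ltW y0).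
  - apply: continuous_subspaceT => x.
    by apply/differentiable_continuous/derivable1_diffP; exact: ex_derive.
  - by rewrite E0 ge_min le_max E_ge ?(ltW y0) ?orbT.
  - rewrite in_itv /= => /andP[x0 _] Ex; exists x => _; split=> //.
    rewrite lt_def x0 andbT; apply: contraTneq y0 => x00.
    by rewrite -Ex x00 E0 ltxx.
have [G GP] := choice E_surj.
have E_pos x : 0 < x -> 0 < E x.
  by move=> x0; rewrite (lt_le_trans x0) // E_ge // ltW.
have E_K x : 0 < x -> G (E x) = x.
  move=> x0; have [G0 GK] := GP _ (E_pos _ x0).
  have [lt|lt|//] := ltgtP (G (E x)) x.
    by have := E_lt _ _ G0 lt; rewrite GK ltxx.
  by have := E_lt _ _ x0 lt; rewrite GK ltxx.
exists E, G; split=> [|x /ltW|k x k0 kx]; last 2 first.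
- exact: E_ge.
- exact: a_dom.
split=> [||x x0|//|//]; first exact: smooth_pos_entire; last first.
  by split; [exact: E_pos|exact: E_K].
apply: (@smooth_pos_inverse R E (entire_fun (pseries_diffs a))) => //; last first.
  by apply: smooth_pos_entire; exact: entire_diffs.
move=> x x0; split=> //; [exact: E_pos|exact: E_K|].
apply: (@lt_le_trans _ _ (pseries (pseries_diffs a) x 1%N)).
  by rewrite /pseries /series /= big_nat1 /pseries_diffs a1 mulr1 mul1r expr0.
apply: nondecreasing_cvgn_le; last exact: entire_diffs.
by apply: nondecreasing_series => n _ _; rewrite !mulr_ge0 // exprn_ge0 // ltW.
Qed.

(** Let [E1], [E2] be provided by [ray_iso_dominating] and
    [P r = 1 / E2^-1 (1 / r)]; both [E1] and [P] lie above the identity.  The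
    map is [r |-> E1 (P r / d)], where [d <= 1] is such that sizes below [d]
    have gain below [1].  It is above [E1 (r / d)], which handles sizes above
    [d], and above [P], which handles smaller ones: a gain of at least
    [1 / (k + 1)] forces the size to be bounded below, which is the condition
    that the growth of [E2] has to encode. *)
Lemma ray_iso_above (R : realType) (T : Type) (size gain : T -> R) :
  (forall M : R, exists C : R, forall i, size i <= M -> gain i <= C) ->
  (forall e : R, 0 < e ->
     exists2 d, 0 < d & forall i, size i < d -> gain i < e) ->
  exists p q : R -> R,
    ray_iso p q /\ forall i, 0 < size i -> gain i <= p (size i).
Proof.
move=> bounded small.
have nat_above (r : R) : exists k : nat, r <= k%:R.
  by exists (Num.truncn r).+1; rewrite ltW // Num.Theory.truncnS_gt.
have floor (r : R) : 1 <= r ->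
    exists k : nat, [/\ (0 < k)%N, k%:R <= r & r <= k.+1%:R].
  move=> r1; have r0 : 0 <= r by exact: le_trans r1.
  have /andP[kr rk] := Num.Theory.truncn_itv r0.
  exists (Num.truncn r); split=> //; last exact: ltW.
  by rewrite -ltnS -(ltr_nat R) (le_lt_trans r1).
have [d0 d0_gt0 small1] := small 1 ltr01.
pose d := Num.min d0 1.
have d_gt0 : 0 < d by rewrite lt_min d0_gt0 ltr01.
have d_le1 : d <= 1 by rewrite ge_min lexx orbT.
have ex1 k : exists c : nat, forall i,
    size i <= k.+1%:R * d -> gain i <= c%:R.
  have [C CP] := bounded (k.+1%:R * d); have [c Cc] := nat_above C.
  by exists c => i /CP /le_trans; apply.
have ex2 k : exists c : nat, forall i, 0 < size i ->
    k.+1%:R^-1 <= gain i -> (size i)^-1 <= c%:R.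
  have [|dk dk0 dkP] := small (k.+1%:R^-1); first by rewrite invr_gt0.
  have [c Cc] := nat_above dk^-1; exists c => i si gi.
  apply: le_trans Cc; rewrite lef_pV2 ?posrE // leNgt; apply/negP => /dkP.
  by rewrite ltNge gi.
have [C1 C1P] := choice ex1; have [C2 C2P] := choice ex2.
have [E1 [G1 [iso1 E1_ge E1_dom]]] := @ray_iso_dominating R C1.
have [E2 [G2 [iso2 E2_ge E2_dom]]] := @ray_iso_dominating R C2.
have isoP := ray_iso_recip (ray_iso_sym iso2).
have [_ _ E2_pos G2_pos _] := iso2.
have [_ _ _ _ G2_lt] := ray_iso_sym iso2.
have d1_gt0 : 0 < d^-1 by rewrite invr_gt0.
pose P r := (G2 r^-1)^-1.
have P_pos r : 0 < r -> 0 < P r.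
  by move=> r0; rewrite invr_gt0; apply G2_pos; rewrite invr_gt0.
have P_ge r : 0 < r -> r <= P r.
  move=> r0; have ri0 : 0 < r^-1 by rewrite invr_gt0.
  have [g0 gK] := G2_pos _ ri0.
  by rewrite -[leLHS]invrK lef_pV2 ?posrE // -[leRHS]gK E2_ge.
exists (fun r => E1 (d^-1 * P r)), (fun r => (E2 (d * G1 r)^-1)^-1).
split.
  have := ray_iso_comp iso1 (ray_iso_comp (ray_iso_scale d1_gt0) isoP).
  by rewrite invrK.
move=> i si; have [ds|sd] := leP d (size i).
  have [|k [k0 ks sk]] := floor (size i / d).
    by rewrite ler_pdivlMr // mul1r.
  apply: (@le_trans _ _ (C1 k)%:R); first by apply: C1P; rewrite -ler_pdivrMr.
  apply: E1_dom => //; apply: le_trans ks _.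
  by rewrite mulrC ler_pM2l // P_ge.
apply: (@le_trans _ _ (P (size i))); last first.
  apply: (@le_trans _ _ (d^-1 * P (size i))).
    by rewrite ler_peMl ?(ltW (P_pos _ si)) // invf_ge1.
  by rewrite E1_ge // mulr_gt0 // P_pos.
have [g0|g0] := leP (gain i) 0; first by rewrite (le_trans g0) // ltW // P_pos.
have g1 : gain i < 1.
  by apply: small1; rewrite (lt_le_trans sd) // ge_min lexx.
have [|k [k0 kg gk]] := floor (gain i)^-1; first by rewrite invf_ge1 // ltW.
have si0 : 0 < (size i)^-1 by rewrite invr_gt0.
have [gs0 gsK] := G2_pos _ si0.
rewrite -[leLHS]invrK lef_pV2 ?posrE ?invr_gt0 //.
have gi0 : 0 < (gain i)^-1 by rewrite invr_gt0.
have [eg0 egK] := E2_pos _ gi0.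
have : (size i)^-1 <= E2 (gain i)^-1.
  apply: (@le_trans _ _ (C2 k)%:R); last exact: E2_dom.
  by apply: C2P => //; rewrite -[leRHS]invrK lef_pV2 ?posrE ?ltr0n.
by rewrite le_eqVlt => /predU1P[->|/(G2_lt _ _ si0)/ltW]; rewrite egK.
Qed.

(** * The chain rule for the square of an indefinite integral *)

Lemma Rintegral_fin (R : realType) (D : set R) (f : R -> R) : measurable D ->
  (@lebesgue_measure R).-integrable D (EFin \o f) ->
  (\int[lebesgue_measure]_(x in D) (f x)%:E)%E =
  (\int[lebesgue_measure]_(x in D) f x)%:E.
Proof. by move=> mD fi; rewrite /Rintegral fineK // integrable_fin_num. Qed.

(** With [I s] the integral of [u] over [0, s], integrating [u s * u r] over the
    triangle [r <= s] in both orders gives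
    [int u s * I s = int u r * (I t - I r)], whence twice the left-hand
    side is [I t ^ 2]. *)
Section primitive_square.
Variables (R : realType) (u : R -> R) (t : R).
Local Notation mu := (@lebesgue_measure R).
Hypothesis ui : mu.-integrable `[0, t] (EFin \o u).

Let I s := \int[mu]_(r in `[0, s]) u r.
Let w := u \_ `[0, t].
Let F (p : R * R) : \bar R := (w p.1 * (if p.2 <= p.1 then w p.2 else 0))%:E.

Let w_out s : s \notin `[0, t] -> w s = 0.
Proof. by move=> st; rewrite /w patchE ifN // notin_setE /= (negbTE st). Qed.

Let restr_integrable a b : `[a, b] `<=` `[0, t] ->
  mu.-integrable setT (EFin \o (u \_ `[a, b])).
Proof.
move=> ab; rewrite -restrict_EFin.
apply: (iffLR (integrable_mkcond _ _)) => //; exact: integrableS ui.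
Qed.

Let wi : mu.-integrable setT (EFin \o w).
Proof. exact: restr_integrable. Qed.

Let mw : measurable_fun setT w.
Proof. by have /integrableP[/measurable_EFinP] := wi. Qed.

Let inner1 s : (\int[mu]_r F (s, r))%E = (w s * I s)%:E.
Proof.
have [st|st] := boolP (s \in `[0, t]); last first.
  rewrite w_out // mul0r -[RHS](integral0 mu setT).
  by apply: eq_integral => r _; rewrite /F /= w_out // mul0r.
have [s0 st'] : 0 <= s /\ s <= t by move: st; rewrite in_itv => /andP[].
have si : mu.-integrable setT (EFin \o (u \_ `[0, s])).
  by apply: restr_integrable; apply: subset_itvl; rewrite bnd_simp.
rewrite /I Rintegral_mkcond EFinM -Rintegral_fin // -integralZl //.
apply: eq_integral => r _; rewrite /F /= -EFinM; congr (_ * _)%:E.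
rewrite /w !patchE !mem_setE !in_itv /=.
by have [rs|sr] := leP r s; rewrite ?andbF ?andbT // (le_trans rs st') andbT.
Qed.

Let inner2 r : (\int[mu]_s F (s, r))%E = (w r * (I t - I r))%:E.
Proof.
have [rt|rt] := boolP (r \in `[0, t]); last first.
  rewrite w_out // mul0r -[RHS](integral0 mu setT).
  by apply: eq_integral => s _; rewrite /F /= (w_out rt) if_same mulr0.
have [r0 rt'] : 0 <= r /\ r <= t by move: rt; rewrite in_itv => /andP[].
have sub : `[r, t] `<=` `[0, t] by apply: subset_itvr; rewrite bnd_simp.
rewrite /I Rintegral_itvB ?bnd_simp //.
rewrite Rintegral_itv_obnd_cbnd; last first.
  apply: integrableS ui => //; apply: subset_trans sub.
  by apply: subset_itvr; rewrite bnd_simp.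
rewrite Rintegral_mkcond EFinM -Rintegral_fin //; last exact: restr_integrable.
rewrite -integralZl //; last exact: restr_integrable.
apply: eq_integral => s _; rewrite /F /= -EFinM; congr _%:E.
rewrite /w !patchE !mem_setE !in_itv /= [RHS]mulrC r0 rt' /=.
have [rs|sr] := leP r s; last by rewrite mulr0 mul0r.
by rewrite (le_trans r0 rs).
Qed.

Let mF : measurable_fun setT F.
Proof.
apply/measurable_EFinP; apply: measurable_funM.
  exact: (measurableT_comp mw measurable_fst).
apply: measurable_fun_ifT => //=; first exact: measurable_fun_ler.
exact: (measurableT_comp mw measurable_snd).
Qed.

Let Fi : (mu \x mu)%E.-integrable setT F.
Proof.
apply/integrable12ltyP => //.
pose N := \int[mu]_r `|w r|.
have wi' : mu.-integrable setT (EFin \o (fun r => `|w r|)).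
  exact: (integrable_abse wi).
have F_le s : (\int[mu]_r `|F (s, r)| <= (`|w s| * N)%:E)%E.
  rewrite EFinM -Rintegral_fin // -integralZl //.
  apply: ge0_le_integral => //.
  - have mFs : measurable_fun setT (fun r => F (s, r)).
      exact: measurable_fun_pair2 mF.
    exact: (measurableT_comp (@abse_measurable R setT) mFs).
  - apply/measurable_EFinP; apply: measurable_funM => //.
    exact: measurableT_comp.
  - move=> r _; rewrite lee_fin normrM ler_wpM2l //.
    by case: ifP => // _; rewrite normr0.
have wNi : mu.-integrable setT (fun s => (`|w s| * N)%:E).
  under eq_fun do rewrite mulrC EFinM.
  exact: integrableZl.
apply: (@le_lt_trans _ _ (\int[mu]_s (`|w s| * N)%:E)%E).
  apply: ge0_le_integral => //.
  - by move=> s _; exact: integral_ge0.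
  - have mG : measurable_fun setT (abse \o F).
      exact: (measurableT_comp (@abse_measurable R setT) mF).
    exact: (measurable_fun_fubini_tonelli_F (m2 := mu) _ mG
      (fun=> abse_ge0 _)).
  - by have /integrableP[] := wNi.
by rewrite Rintegral_fin // ltry.
Qed.

Lemma primitive_square :
  mu.-integrable `[0, t] (fun s => (u s * I s)%:E) /\
  2 * \int[mu]_(s in `[0, t]) (u s * I s) = I t ^+ 2.
Proof.
have wI : (fun s => (w s * I s)%:E) = (fun s => (u s * I s)%:E) \_ `[0, t].
  apply/funext => s; rewrite /w patchE /= patchE; case: ifP => // _.
  by rewrite mul0r.
have uIi : mu.-integrable `[0, t] (fun s => (u s * I s)%:E).
  apply: (iffRL (integrable_mkcond _ _)) => //; rewrite -wI.
  apply: eq_integrable (integrable_fubini_F Fi) => // s _; exact: inner1.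
split=> //.
have := Fubini Fi.
under eq_integral do rewrite inner1.
under [in RHS]eq_integral do rewrite inner2.
have -> : (fun r => (w r * (I t - I r))%:E) =
    (fun r => (u r * (I t - I r))%:E) \_ `[0, t].
  apply/funext => s; rewrite /w patchE /= patchE; case: ifP => // _.
  by rewrite mul0r.
rewrite wI -!integral_mkcond.
have uIt : mu.-integrable `[0, t] (fun s => (u s * I t)%:E).
  have -> : (fun s => (u s * I t)%:E) = (fun s => ((I t)%:E * (u s)%:E)%E).
    by apply/funext => s; rewrite mulrC EFinM.
  exact: integrableZl.
have E : (fun r => (u r * (I t - I r))) = (fun r => u r * I t - u r * I r).
  by apply/funext => r; rewrite mulrBr.
rewrite Rintegral_fin // Rintegral_fin //; last first.
  by rewrite E; apply: eq_integrable (integrableB _ uIt uIi).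
rewrite E => -[]; rewrite RintegralB // RintegralZr // => h.
by rewrite mulr2n mulrDl mul1r {1}h subrK expr2.
Qed.
End primitive_square.

(** * Energy balance along solutions *)

Definition dot (R : realType) (n : nat) (x y : 'rV[R]_n) : R :=
  \sum_(i < n) x 0 i * y 0 i.

Lemma enorm_ge0 (R : realType) (n : nat) (x : 'rV[R]_n) : 0 <= enorm x.
Proof. exact: sqrtr_ge0. Qed.

Lemma sqr_enorm (R : realType) (n : nat) (x : 'rV[R]_n) :
  enorm x ^+ 2 = sqnorm x.
Proof. by rewrite sqr_sqrtr // sqnorm_ge0. Qed.

Lemma enorm_gt0 (R : realType) (n : nat) (x : 'rV[R]_n) :
  (0 < enorm x) = (x != 0).
Proof. by rewrite sqrtr_gt0 -/(sqnorm x) sqnorm_gt0. Qed.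

Lemma enorm0 (R : realType) (n : nat) : enorm (0 : 'rV[R]_n) = 0.
Proof. by apply/eqP; rewrite eq_le enorm_ge0 andbT leNgt enorm_gt0 eqxx. Qed.

Lemma dotxx (R : realType) (n : nat) (x : 'rV[R]_n) : dot x x = enorm x ^+ 2.
Proof. by rewrite sqr_enorm; apply: eq_bigr => i _; rewrite expr2. Qed.

Lemma dot0l (R : realType) (n : nat) (y : 'rV[R]_n) : dot 0 y = 0.
Proof. by apply: big1 => i _; rewrite mxE mul0r. Qed.

(** The Cauchy-Schwarz inequality, from the squared norm of
    [|y| x - |x| y]. *)
Lemma dot_le_enorm (R : realType) (n : nat) (x y : 'rV[R]_n) :
  dot x y <= enorm x * enorm y.
Proof.
have [->|x0] := eqVneq x 0.
  by rewrite dot0l mulr_ge0 ?enorm_ge0.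
have [->|y0] := eqVneq y 0.
  rewrite (_ : dot x 0 = 0) ?mulr_ge0 ?enorm_ge0 //.
  by apply: big1 => i _; rewrite mxE mulr0.
have := sqnorm_ge0 (enorm y *: x - enorm x *: y).
have -> : sqnorm (enorm y *: x - enorm x *: y) =
    enorm y ^+ 2 * sqnorm x - 2 * (enorm x * enorm y) * dot x y
    + enorm x ^+ 2 * sqnorm y.
  rewrite /sqnorm /dot !mulr_sumr -sumrB -big_split; apply: eq_bigr => i _ /=.
  by rewrite !mxE; ring.
rewrite -!sqr_enorm -(enorm_gt0 x) -(enorm_gt0 y) in x0 y0 *.
have p0 := mulr_gt0 x0 y0.
by move=> q0; rewrite -(ler_pM2l p0); nra.
Qed.

Lemma Rintegral_sum (R : realType) (J : interval R) (I : Type) (r : seq I)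
    (u : I -> R -> R) (D := [set` J]) :
  (forall i, (@lebesgue_measure R).-integrable D (EFin \o u i)) ->
  (@lebesgue_measure R).-integrable D
    (EFin \o (fun s => \sum_(i <- r) u i s)) /\
  \int[lebesgue_measure]_(s in D) (\sum_(i <- r) u i s) =
  \sum_(i <- r) \int[lebesgue_measure]_(s in D) u i s.
Proof.
have mD : measurable D by exact: measurable_itv.
move=> ui; elim: r => [|i r [IHi IHe]].
  have -> : (fun s => \sum_(i <- [::]) u i s) = cst 0.
    by apply/funext => s; rewrite big_nil.
  split; first exact: integrable0.
  by rewrite big_nil Rintegral_cst // mul0r.
have -> : (fun s => \sum_(j <- i :: r) u j s) =
    (fun s => u i s + \sum_(j <- r) u j s).
  by apply/funext => s; rewrite big_cons.
split; first by apply: eq_integrable (integrableD _ (ui i) IHi).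
by rewrite big_cons RintegralD // IHe.
Qed.

Section solution_facts.
Variables (R : realType) (n m : nat) (F : 'rV[R]_n -> 'rV[R]_m -> 'rV[R]_n).
Variables (x : 'rV[R]_n) (v : R -> 'rV[R]_m) (T : \bar R) (phi : R -> 'rV[R]_n).
Hypothesis sol : solution F x v T phi.
Local Notation mu := (@lebesgue_measure R).

Lemma solution_integrable t i : 0 <= t -> (t%:E < T)%E ->
  mu.-integrable `[0, t] (EFin \o (fun s => F (phi s) (v s) 0 i)).
Proof. by move=> t0 tT; have [_ /(_ t t0 tT i)[]] := sol. Qed.

Lemma solution_eq t i : 0 <= t -> (t%:E < T)%E ->
  phi t 0 i = x 0 i + \int[mu]_(s in `[0, t]) F (phi s) (v s) 0 i.
Proof. by move=> t0 tT; have [_ /(_ t t0 tT i)[]] := sol. Qed.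

Lemma solution0 : phi 0 = x.
Proof.
have [T0 _] := sol; apply/rowP => i.
by rewrite solution_eq // set_itv1 Rintegral_set1 addr0.
Qed.

Lemma solution_dot (y : 'rV[R]_n) t : 0 <= t -> (t%:E < T)%E ->
  mu.-integrable `[0, t] (EFin \o (fun s => dot y (F (phi s) (v s)))) /\
  dot y (phi t) = dot y x + \int[mu]_(s in `[0, t]) dot y (F (phi s) (v s)).
Proof.
move=> t0 tT.
have [|I1 I2] := @Rintegral_sum R `[0, t]%R _ (index_enum 'I_n)
  (fun i s => y 0 i * F (phi s) (v s) 0 i).
  move=> i; have Fi := solution_integrable i t0 tT.
  exact: eq_integrable (integrableZl _ (y 0 i) Fi).
split=> //; rewrite /dot I2 -big_split; apply: eq_bigr => i _ /=.
rewrite RintegralZl //; last exact: solution_integrable.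
by rewrite -mulrDr -solution_eq.
Qed.

(** The square of each coordinate of a solution is integrated by
    [primitive_square]. *)
Lemma solution_energy t : 0 <= t -> (t%:E < T)%E ->
  mu.-integrable `[0, t]
    (EFin \o (fun s => 2 * dot (phi s) (F (phi s) (v s)))) /\
  \int[mu]_(s in `[0, t]) (2 * dot (phi s) (F (phi s) (v s))) =
  enorm (phi t) ^+ 2 - enorm x ^+ 2.
Proof.
move=> t0 tT.
pose u i s := F (phi s) (v s) 0 i.
pose I i s := \int[mu]_(r in `[0, s]) u i r.
have ui i : mu.-integrable `[0, t] (EFin \o u i) by exact: solution_integrable.
have sq i := primitive_square (ui i).
have phiE s i : s \in `[0, t] -> phi s 0 i = x 0 i + I i s.
  rewrite in_itv => /andP[s0 st]; apply: solution_eq => //.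
  by apply: le_lt_trans tT; rewrite lee_fin.
pose h i s := 2 * x 0 i * u i s + 2 * (u i s * I i s).
have h1i i : mu.-integrable `[0, t] (EFin \o (fun s => 2 * x 0 i * u i s)).
  exact: eq_integrable (integrableZl _ (2 * x 0 i) (ui i)).
have h2i i : mu.-integrable `[0, t] (EFin \o (fun s => 2 * (u i s * I i s))).
  exact: eq_integrable (integrableZl _ 2 (sq i).1).
have hi i : mu.-integrable `[0, t] (EFin \o h i).
  exact: eq_integrable (integrableD _ (h1i i) (h2i i)).
have hE i : \int[mu]_(s in `[0, t]) h i s = phi t 0 i ^+ 2 - x 0 i ^+ 2.
  rewrite RintegralD // RintegralZl // RintegralZl //; last exact: (sq i).1.
  rewrite (sq i).2 phiE ?in_itv /= ?t0 ?lexx // -/(I i t); ring.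
have [si sE] := Rintegral_sum (index_enum 'I_n) hi.
have E s : s \in `[0, t] ->
    2 * dot (phi s) (F (phi s) (v s)) = \sum_(i < n) h i s.
  move=> st; rewrite /dot mulr_sumr; apply: eq_bigr => i _.
  by rewrite phiE // /h /u; ring.
split.
  by apply: eq_integrable si => // s; rewrite inE /= => /E ->.
transitivity (\int[mu]_(s in `[0, t]) \sum_(i < n) h i s).
  by apply: eq_Rintegral => s; rewrite inE => /E.
rewrite sE !sqr_enorm /sqnorm -sumrB.
by apply: eq_bigr => i _; exact: hE.
Qed.

Lemma solution_measurable t i : 0 <= t -> (t%:E < T)%E ->
  measurable_fun `[0, t] (fun s => phi s 0 i).
Proof.
move=> t0 tT.
have mI : measurable_fun `[0, t]
    (fun s => x 0 i + \int[mu]_(r in `[0, s]) F (phi r) (v r) 0 i).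
  apply: measurable_funD => //; apply: subspace_continuous_measurable_fun => //.
  by apply: parameterized_integral_continuous => //; exact: solution_integrable.
apply: eq_measurable_fun mI => s; rewrite inE /= in_itv /= => /andP[s0 st].
by rewrite -solution_eq // (le_lt_trans _ tT) // lee_fin.
Qed.

Lemma solution_cvg0 t : 0 < t -> (t%:E < T)%E -> phi s @[s --> 0^'+] --> x.
Proof.
move=> t0 tT; apply: (cvg_row (F := 0^'+)) => i.
have ui := solution_integrable i (ltW t0) tT.
have c : x 0 i + parameterized_integral mu 0 s (fun r => F (phi r) (v r) 0 i)
    @[s --> 0^'+] --> x 0 i + 0.
  apply: cvgD; first exact: cvg_cst.
  exact: cvg_at_right_filter (parameterized_integral_cvg_left t0 ui).
rewrite addr0 in c; apply: cvg_trans c; apply: near_eq_cvg; near=> s.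
rewrite [in RHS]solution_eq //.
apply: le_lt_trans tT; rewrite lee_fin ltW //.
Unshelve. all: by end_near. Qed.

End solution_facts.

(** The integrated inequality reads
    [int |phi|^2 <= int |v|^2 - (|phi t|^2 - |x|^2)].  It
    presupposes that [|v|^2] is integrable; otherwise the right-hand side of
    the claim is infinite. *)
Lemma dissipation_L2_gain (R : realType) (n m : nat) (D : set 'rV[R]_m)
    (F : 'rV[R]_n -> 'rV[R]_m -> 'rV[R]_n) :
  (forall y v, D v -> 2 * dot y (F y v) + enorm y ^+ 2 <= enorm v ^+ 2) ->
  forall x v T phi, admissible_input D v -> solution F x v T phi ->
  forall t, 0 <= t -> (t%:E < T)%E ->
  (\int[lebesgue_measure]_(s in `[0%R, t]) (enorm (phi s) ^+ 2)%:E <=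
   (enorm x ^+ 2)%:E +
   \int[lebesgue_measure]_(s in `[0%R, t]) (enorm (v s) ^+ 2)%:E)%E.
Proof.
move=> diss x v T phi [vD mv _] sol t t0 tT.
pose mu := @lebesgue_measure R.
have msq p (y : R -> 'rV[R]_p) :
    (forall i, measurable_fun `[0, t] (fun s => y s 0 i)) ->
    measurable_fun `[0, t] (fun s => (enorm (y s) ^+ 2)%:E).
  move=> my; apply/measurable_EFinP.
  have -> : (fun s => enorm (y s) ^+ 2) = (fun s => \sum_(i < p) y s 0 i ^+ 2).
    by apply/funext => s; rewrite sqr_enorm.
  by apply: measurable_sum => i; apply: measurable_funX.
have mphi := msq _ _ (fun i => solution_measurable sol i t0 tT).
have mvs : measurable_fun `[0, t] (fun s => (enorm (v s) ^+ 2)%:E).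
  by apply: msq => i; exact: measurable_funS (mv i).
have [Ei EE] := solution_energy sol t0 tT.
have [vi|vinf] := pselect (mu.-integrable `[0, t]
    (fun s => (enorm (v s) ^+ 2)%:E)); last first.
  suff -> : (\int[mu]_(s in `[0%R, t]) (enorm (v s) ^+ 2)%:E = +oo)%E.
    by rewrite addey ?leey.
  apply: contrapT => vfin; apply: vinf; apply/integrableP; split=> //.
  under eq_integral do rewrite /= ger0_norm ?sqr_ge0 //.
  by rewrite ltey; apply/eqP.
have di : mu.-integrable `[0, t] (EFin \o (fun s => enorm (v s) ^+ 2 -
    2 * dot (phi s) (F (phi s) (v s)))).
  exact: eq_integrable (integrableB _ vi Ei).
pose h s := enorm (v s) ^+ 2 - 2 * dot (phi s) (F (phi s) (v s)).
have : (\int[lebesgue_measure]_(s in `[0%R, t]) (enorm (phi s) ^+ 2)%:E <=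
  \int[lebesgue_measure]_(s in `[0%R, t]) (h s)%:E)%E.
  apply: ge0_le_integral => //.
  - by move=> s _; rewrite lee_fin sqr_ge0.
  - by have /integrableP[] := di.
  - move=> s _; rewrite lee_fin /h; have := diss (phi s) _ (vD s).
    by have := sqr_ge0 (enorm (phi s)); lra.
move=> /le_trans; apply.
rewrite Rintegral_fin // Rintegral_fin // -EFinD lee_fin RintegralB // EE.
by have := sqr_ge0 (enorm (phi t)); lra.
Qed.

(** * Dissipation outside the stability gain *)

Lemma continuous_at_fixed_input (R : realType) (n m : nat) (D : set 'rV[R]_m)
    (f : 'rV[R]_n -> 'rV[R]_m -> 'rV[R]_n) (d : 'rV[R]_m) :
  {within [set z : 'rV[R]_n * 'rV[R]_m | D z.2],
    continuous (fun z => f z.1 z.2)} ->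
  D d -> continuous (fun y => f y d).
Proof.
move=> /subspace_continuousP fc Dd x.
apply: (cvg_comp (fun y => (y, d)) _ _ (fc (x, d) Dd)).
have pc : (y, d) @[y --> x] --> (x, d).
  have cd : (fun=> d) @ nbhs x --> nbhs d by exact: cvg_cst.
  exact: (@cvg_pair _ _ _ (nbhs x) (nbhs x) (nbhs d) _ _ _ id _ cvg_id cd).
by move=> W /pc; apply: (@filterS _ (nbhs x)) => y /=; apply.
Qed.

Lemma admissible_cst (R : realType) (m : nat) (D : set 'rV[R]_m) d :
  D d -> admissible_input D (fun=> d).
Proof.
move=> Dd; split=> // a b.
by exists (enorm d); exact: aeW.
Qed.

(** On a null interval the essential supremum is [0], hence no equality. *)
Lemma ess_sup_norm_cst (R : realType) (m : nat) (d : 'rV[R]_m) t :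
  0 <= ess_sup_norm (fun=> d) t <= enorm d.
Proof.
rewrite /ess_sup_norm; set k := (X in ess_sup _ X).
have k_ge s : (0 <= k s)%E.
  by rewrite /k patchE; case: ifP => // _; rewrite lee_fin enorm_ge0.
have k_le s : (k s <= (enorm d)%:E)%E.
  by rewrite /k patchE; case: ifP => // _; rewrite lee_fin enorm_ge0.
have le : (ess_sup lebesgue_measure k <= (enorm d)%:E)%E.
  by apply/ess_supP; exact: aeW.
have ge : (0 <= ess_sup lebesgue_measure k)%E.
  apply: ess_sup_gee; last first.
    exact: aeW.
  have -> : [set: R] = [set` `]-oo, +oo[%R] by rewrite set_itvE.
  by rewrite /= lebesgue_measure_itv /= ltry.
rewrite fine_ge0 //= -lee_fin fineK // fin_numE.
by case: (ess_sup _ _) le ge.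
Qed.

Lemma Kinfty_le (R : realType) (alpha : R -> R) r s :
  class_Kinfty alpha -> 0 <= r -> r <= s -> alpha r <= alpha s.
Proof.
move=> [_ a_lt _ _] r0; rewrite le_eqVlt => /predU1P[->//|rs].
by apply/ltW/a_lt => //; rewrite in_itv /= andbT // (le_trans r0) // ltW.
Qed.

(** Let [N = |x|] and let [phi] be a solution with constant input [d].  For
    small [t] the first term of the stability estimate is the larger one, so
    [<x, phi t> <= exp (- t) N ^ 2 <= N ^ 2 / (1 + t)].  On the other hand
    [<x, phi t>] is [N ^ 2] plus the integral of [<x, f (phi s, d)>], which is
    at least [t (<x, f (x, d)> - eta / 2)] for small [t].  Testing against the
    fixed vector [x] keeps the integrand linear in [f], so no chain rule is
    needed. *)
Lemma ISES_dissipation (R : realType) (n m : nat) (D : set 'rV[R]_m)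
    (f : 'rV[R]_n -> 'rV[R]_m -> 'rV[R]_n) (alpha : R -> R) x d :
  (forall d, D d -> continuous (fun y => f y d)) ->
  class_Kinfty alpha -> ISES D f 1 1 alpha ->
  D d -> alpha (enorm d) < enorm x -> dot x (f x d) <= - enorm x ^+ 2.
Proof.
move=> fc aK [fwd est] Dd adx.
have adm := admissible_cst Dd.
have [[phi sol] _] := fwd x _ adm.
have max : maximal_solution f x (fun=> d) +oo%E phi.
  by split=> // T' psi; rewrite leye_eq => /eqP.
pose N := enorm x; pose A := alpha (enorm d).
have A0 : 0 <= A.
  by have [_ _ <- _] := aK; apply: Kinfty_le => //; exact: enorm_ge0.
have N0 : 0 < N by exact: le_lt_trans adx.
have phi_le t : 0 <= t -> enorm (phi t) <= Num.max (expR (- t) * N) A.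
  move=> t0; apply: le_trans (est x _ phi adm max t t0) _.
  rewrite !mul1r ge_max le_max lexx /= le_max; apply/orP; right.
  have /andP[e0 e1] := ess_sup_norm_cst d t.
  exact: Kinfty_le.
rewrite leNgt; apply/negP => gt.
pose eta := dot x (f x d) + N ^+ 2.
have eta0 : 0 < eta by rewrite /eta -ltrBlDr sub0r.
pose k s := dot x (f (phi s) d).
have k_near : \forall s \near 0^'+, dot x (f x d) - eta / 2 < k s.
  have c : k s @[s --> 0^'+] --> dot x (f x d).
    apply: (@cvg_comp _ _ _ phi (fun y => dot x (f y d))).
      by apply: (solution_cvg0 sol) ltr01 _; rewrite ltry.
    apply: cvg_big => [|i _]; first exact: add_continuous.
    apply: cvgM; first exact: cvg_cst.
    exact: (cvg_comp _ _ (fc d Dd x) (@coord_continuous _ _ _ 0 i _)).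
  by apply: (cvgr_gt _ c); rewrite ltrBlDr ltrDl divr_gt0.
case: k_near => b /= b0 kb.
have k_ge s : 0 <= s -> s < b -> dot x (f x d) - eta / 2 <= k s.
  rewrite le_eqVlt => /predU1P[<- _|s0 sb].
    by rewrite /k (solution0 sol) lerBlDr lerDl divr_ge0 // ltW.
  by apply/ltW/kb => //=; rewrite sub0r normrN gtr0_norm.
(* a time at which the two bounds on [dot x (phi t)] contradict each other *)
have [t [t0 tb tA tN]] : exists t, [/\ 0 < t, t < b, A <= expR (- t) * N
    & t * N ^+ 2 < eta / 2].
  have den : 0 < 2 * (N ^+ 2 + 1) by rewrite mulr_gt0 // ltr_wpDl ?sqr_ge0.
  pose r := Num.min (b / 2) (Num.min ((N - A) / N) (eta / (2 * (N ^+ 2 + 1)))).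
  have NA : 0 < N - A by rewrite subr_gt0.
  exists r; split.
  - by rewrite !lt_min !divr_gt0.
  - by rewrite gt_min; apply/orP; left; lra.
  - have rNA : r <= (N - A) / N by rewrite !ge_min lexx orbT.
    rewrite ler_pdivlMr // in rNA.
    have := expR_ge1Dx (- r) => er.
    apply: (@le_trans _ _ ((1 + - r) * N)); last by rewrite ler_wpM2r // ltW.
    by lra.
  - have re : r <= eta / (2 * (N ^+ 2 + 1)) by rewrite !ge_min lexx !orbT.
    have r0 : 0 < r by rewrite !lt_min !divr_gt0.
    rewrite ler_pdivlMr // in re; nra.
have tT : (t%:E < +oo)%E by rewrite ltry.
have [ki dphi] := solution_dot sol x (ltW t0) tT.
have phi_ge : N ^+ 2 + t * (dot x (f x d) - eta / 2) <= dot x (phi t).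
  rewrite dphi dotxx lerD2l.
  have -> : t * (dot x (f x d) - eta / 2) =
      \int[lebesgue_measure]_(s in `[0, t]) (dot x (f x d) - eta / 2).
    rewrite Rintegral_cst //= lebesgue_measure_itv /= lte_fin t0 /=.
    by rewrite subr0 mulrC.
  apply: le_Rintegral => // [|s /=].
    apply: continuous_compact_integrable; first exact: segment_compact.
    by apply: continuous_subspaceT => s; exact: cvg_cst.
  rewrite in_itv /= => /andP[s0 st]; apply: k_ge => //.
  exact: le_lt_trans st tb.
have phi_N : enorm (phi t) <= expR (- t) * N.
  by apply: le_trans (phi_le t (ltW t0)) _; rewrite ge_max lexx tA.
have : dot x (phi t) <= expR (- t) * N ^+ 2.
  apply: le_trans (dot_le_enorm _ _) _.
  by rewrite mulrC expr2 mulrA ler_pM2r.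
have e1 : (1 + t) * expR (- t) <= 1.
  by rewrite expRN ler_pdivrMr ?expR_gt0 // mul1r expR_ge1Dx.
move=> phi_le2.
have : (1 + t) * (N ^+ 2 + t * (dot x (f x d) - eta / 2)) <= N ^+ 2.
  apply: (@le_trans _ _ ((1 + t) * (expR (- t) * N ^+ 2))).
    by rewrite ler_wpM2l ?(le_trans phi_ge) // addr_ge0 // ltW.
  by rewrite mulrA ler_piMl // sqr_ge0.
have -> : dot x (f x d) = eta - N ^+ 2 by rewrite /eta addrK.
have N2 : 0 < N ^+ 2 by rewrite exprn_gt0.
move=> h; have : t * ((1 + t) * (eta / 2) - t * N ^+ 2) <= 0 by nra.
rewrite pmulr_rle0 //; nra.
Qed.

(** * Radial homeomorphisms *)

Lemma smooth_pos_sqrt (R : realType) : smooth_pos (@Num.sqrt R).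
Proof.
apply: (@smooth_pos_inverse R (fun x => x ^+ 2) (fun x => 2 * x))
  => [x x0|y y0|].
- split; last by rewrite mulr_gt0.
  + by rewrite exprn_gt0.
  + by rewrite sqrtr_sqr gtr0_norm.
  + by apply: is_derive_eq; rewrite /GRing.scale /=; ring.
- by rewrite sqrtr_gt0 sqr_sqrtr // ltW.
- exact: smooth_posM (smooth_pos_cst 2) (smooth_pos_id R).
Qed.

(** At the origin the default value of the quotient is harmless: it multiplies
    the zero vector. *)
Definition radial (R : realType) (m : nat) (p : R -> R) (x : 'rV[R]_m) :
    'rV[R]_m :=
  (p (enorm x) / enorm x) *: x.

Lemma radial0 (R : realType) (m : nat) (p : R -> R) :
  radial p (0 : 'rV[R]_m) = 0.
Proof. exact: scaler0. Qed.

Lemma enorm_radial (R : realType) (m : nat) (p : R -> R) (x : 'rV[R]_m) :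
  x != 0 -> 0 <= p (enorm x) -> enorm (radial p x) = p (enorm x).
Proof.
move=> x0 p0; have N0 : 0 < enorm x by rewrite enorm_gt0.
apply/eqP; rewrite -(@eqrXn2 _ 2) ?enorm_ge0 // sqr_enorm /sqnorm.
under eq_bigr do rewrite mxE exprMn.
by rewrite -mulr_sumr -/(sqnorm x) -sqr_enorm -exprMn divfK // gt_eqF.
Qed.

Lemma smooth_on_radial (R : realType) (m : nat) (p : R -> R) : smooth_pos p ->
  smooth_on [set x : 'rV[R]_m | x != 0] (radial p).
Proof.
move=> sp; apply: smooth_on_away0 => k.
pose ps (s : R) := p (Num.sqrt s) * (Num.sqrt s)^-1.
exists (fun x => ps (sqnorm x) * x 0 k); last by move=> x _; rewrite mxE.
apply: smooth_away0M (smooth_away0_coord _ k).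
apply: smooth_away0_radial; have sq0 (x : R) : 0 < x -> 0 < Num.sqrt x.
  by rewrite sqrtr_gt0.
apply: smooth_posM; last exact: smooth_posV (smooth_pos_sqrt R).
exact: smooth_pos_comp (smooth_pos_sqrt R).
Qed.

Lemma radial_can (R : realType) (m : nat) (p q : R -> R) : ray_iso p q ->
  cancel (@radial R m p) (@radial R m q).
Proof.
move=> [_ _ pP _ _] x; have [->|x0] := eqVneq x 0; first by rewrite !radial0.
have N0 : 0 < enorm x by rewrite enorm_gt0.
have [pN pK] := pP _ N0.
rewrite {1}/radial enorm_radial // ?ltW // pK /radial scalerA.
by rewrite mulrA divfK ?gt_eqF // divff ?gt_eqF // scale1r.
Qed.

Lemma enorm_continuous (R : realType) (m : nat) : continuous (@enorm R m).
Proof.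
move=> x; apply: continuous_comp; first exact: continuous_sqnorm.
exact: sqrt_continuous.
Qed.

Lemma coord_le_enorm (R : realType) (m : nat) (x : 'rV[R]_m) k :
  `|x 0 k| <= enorm x.
Proof.
rewrite -(@ler_pXn2r _ 2) ?nnegrE ?enorm_ge0 // sqr_enorm.
rewrite real_normK ?num_real //.
by rewrite /sqnorm (bigD1 k) //= lerDl sumr_ge0 // => i _; rewrite sqr_ge0.
Qed.

(** Off the origin the map is smooth; at the origin, [|y| < q e] implies
    [|radial p y| = p |y| < e]. *)
Lemma radial_continuous (R : realType) (m : nat) (p q : R -> R) : ray_iso p q ->
  continuous (@radial R m p).
Proof.
move=> pq; have [sp _ pP qP p_lt] := pq.
move=> x; have [->|x0] := eqVneq x 0; last first.
  by have [] := @smooth_on_radial R m p sp [::] x x0.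
apply: (cvg_row (F := nbhs (0 : 'rV[R]_m))) => k; rewrite radial0 mxE.
apply/cvgrPdist_lt => e e0; have [q0 qK] := qP _ e0.
have near_q : \forall y \near (0 : 'rV[R]_m), enorm y < q e.
  have := @enorm_continuous R m 0; rewrite /continuous_at.
  by rewrite enorm0; move=> /(cvgr_lt _) /(_ _ q0).
apply: filterS near_q => y yq; rewrite sub0r normrN.
apply: le_lt_trans (coord_le_enorm (radial p y) k) _.
have [->|y0] := eqVneq y 0.
  by rewrite radial0 enorm0.
have N0 : 0 < enorm y by rewrite enorm_gt0.
rewrite enorm_radial //; last by have [/ltW] := pP _ N0.
by rewrite -qK; exact: p_lt.
Qed.

Lemma radial_homeomorphism (R : realType) (m : nat) (p q : R -> R) :
  ray_iso p q -> homeomorphism_with_inverse (@radial R m p) (@radial R m q).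
Proof.
move=> pq; have qp := ray_iso_sym pq.
by split; [exact: radial_can|exact: radial_can|exact: radial_continuous pq|
  exact: radial_continuous qp].
Qed.

(** * The nonlinear gain estimate *)

Lemma measurable_radial (R : realType) (m : nat) (p : R -> R)
    (v : R -> 'rV[R]_m) : smooth_pos p ->
  (forall i, measurable_fun setT (fun t => v t 0 i)) ->
  forall i, measurable_fun setT (fun t => radial p (v t) 0 i).
Proof.
move=> sp mv i.
pose c : R -> R := (fun r => p r * r^-1) \_ `]0, +oo[.
have mc : measurable_fun setT c.
  apply: (iffLR (measurable_restrictT _ _)) => //.
  apply: open_continuous_measurable_fun => //.
  move=> r; rewrite inE /= in_itv /= andbT => r0.
  apply: (smooth_pos_continuous _ r0); apply: smooth_posM => //.
  by apply: smooth_posV => //; exact: smooth_pos_id.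
have mN : measurable_fun setT (fun t => enorm (v t)).
  apply: (measurableT_comp (continuous_measurable_fun (@sqrt_continuous R))).
  by apply: measurable_sum => j; apply: measurable_funX.
have -> : (fun t => radial p (v t) 0 i) = (fun t => c (enorm (v t)) * v t 0 i).
  apply/funext => t; rewrite /c patchE mxE; case: ifPn => // N0.
  have [->|v0] := eqVneq (v t) 0; first by rewrite mxE !mulr0.
  by move: N0; rewrite notin_setE /= in_itv /= andbT enorm_gt0 v0.
by apply: measurable_funM => //; exact: measurableT_comp mN.
Qed.

(** Solutions of the transformed system for [v] are those of the original one
    for [radial q \o v], so forward completeness carries over once this is an
    admissible input. *)
Lemma admissible_radial (R : realType) (m : nat) (D : set 'rV[R]_m)
    (p q : R -> R) (v : R -> 'rV[R]_m) : ray_iso p q ->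
  admissible_input (radial p @` D) v -> admissible_input D (radial q \o v).
Proof.
move=> pq [vD mv bv]; have qp := ray_iso_sym pq; split.
- by move=> t; have [d Dd dE] := vD t; rewrite /= -dE (radial_can pq).
- by apply: measurable_radial mv; have [] := qp.
- have [_ _ _ qP q_lt] := pq; move=> a b; have [M vM] := bv a b.
  exists (q (Num.max M 1)).
  apply: (filterS (F := almost_everywhere lebesgue_measure)) vM => t vM tab.
  have vt := vM tab.
  have M0 : 0 < Num.max M 1 by rewrite lt_max ltr01 orbT.
  have [qM _] := qP _ M0.
  have [v0|v0] := eqVneq (v t) 0.
    by rewrite /= v0 radial0 enorm0 ltW.
  have N0 : 0 < enorm (v t) by rewrite enorm_gt0.
  rewrite /= enorm_radial //; last by have [/ltW] := qP _ N0.
  have : enorm (v t) <= Num.max M 1 by rewrite le_max vt.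
  rewrite le_eqVlt => /predU1P[->//|lt]; apply: ltW.
  by have [_ _ _ _] := qp; apply.
Qed.

Lemma Kinfty_small (R : realType) (alpha : R -> R) (e : R) :
  class_Kinfty alpha -> 0 < e ->
  exists2 d, 0 < d & forall r, 0 <= r -> r < d -> alpha r < e.
Proof.
move=> [ac _ a0 _] e0; move/subspace_continuousP/(_ 0) in ac.
have /ac : `[0, +oo[%classic (0 : R) by rewrite /= in_itv /= lexx.
rewrite /from_subspace a0 => /cvgrPdist_lt/(_ _ e0); case=> d /= d0 H.
exists d => // r r0 rd; have := H r.
rewrite /= !sub0r !normrN ger0_norm // in_itv /= andbT.
move=> /(_ rd r0); exact: le_lt_trans (ler_norm _).
Qed.

(** The pairs [(x, d)] with [|x| <= alpha(|d|)], on which the stability estimate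
    gives no decay; [gain] is the square root of the excess that [|v|^2] has to
    compensate. *)
Section gain.
Variables (R : realType) (n m : nat) (D : set 'rV[R]_m).
Variables (f : 'rV[R]_n -> 'rV[R]_m -> 'rV[R]_n) (alpha : R -> R).
Hypothesis fb : bounded_on_bounded_sets D f.
Hypothesis aK : class_Kinfty alpha.

Let S := {z : 'rV[R]_n * 'rV[R]_m | D z.2 /\ enorm z.1 <= alpha (enorm z.2)}.
Let size (z : S) := enorm (sval z).2.
Let gain (z : S) :=
  Num.sqrt (2 * dot (sval z).1 (f (sval z).1 (sval z).2)
            + enorm (sval z).1 ^+ 2).

(* On [|d| <= M] the excess is at most [alpha(|d|) * C]: bounded on bounded
   sets, and small for small [d]. *)
Let gain_bound M : exists2 C, 0 <= C &
  forall z, size z <= M -> gain z ^+ 2 <= alpha (size z) * C.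
Proof.
have a0 : alpha 0 = 0 by have [_ _ ->] := aK.
pose A := alpha (Num.max M 0).
have [C0 fC0] := fb (Num.max M A).
pose C := Num.max C0 0; have C_ge0 : 0 <= C by rewrite le_max lexx orbT.
have A_ge0 : 0 <= A by rewrite -a0 Kinfty_le // le_max lexx orbT.
exists (2 * C + A) => [|[[x d] /= [Dd xd]]].
  by rewrite addr_ge0 // mulr_ge0.
rewrite /size /gain /= => dM.
have d_ge0 := enorm_ge0 d; have x_ge0 := enorm_ge0 x.
have adA : alpha (enorm d) <= A by rewrite Kinfty_le // le_max dM.
have fC : enorm (f x d) <= C.
  rewrite le_max fC0 // le_max ?dM ?(le_trans xd adA) ?orbT //.
have dC : dot x (f x d) <= enorm x * C.
  by apply: le_trans (dot_le_enorm _ _) _; rewrite ler_wpM2l.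
have xA : enorm x ^+ 2 <= enorm x * A.
  by rewrite expr2 ler_wpM2l // (le_trans xd).
have ub : 2 * dot x (f x d) + enorm x ^+ 2 <= alpha (enorm d) * (2 * C + A).
  apply: (@le_trans _ _ (enorm x * (2 * C + A))); first by lra.
  by apply: ler_wpM2r => //; rewrite addr_ge0 // mulr_ge0.
have ub0 : 0 <= alpha (enorm d) * (2 * C + A).
  apply: mulr_ge0; first exact: le_trans xd.
  by rewrite addr_ge0 // mulr_ge0.
have [h|h] := leP 0 (2 * dot x (f x d) + enorm x ^+ 2).
  by rewrite sqr_sqrtr.
by rewrite ltr0_sqrtr // expr0n.
Qed.

Lemma gain_dominated : exists p q : R -> R, ray_iso p q /\
  forall x d, D d -> d != 0 -> enorm x <= alpha (enorm d) ->
  2 * dot x (f x d) + enorm x ^+ 2 <= p (enorm d) ^+ 2.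
Proof.
have [||p [q [pq gp]]] := @ray_iso_above R S size gain.
- move=> M; have [C C0 gC] := gain_bound M; pose B := alpha (Num.max M 0) * C.
  exists (Num.sqrt B) => z zM.
  rewrite -[leLHS](ger0_norm (sqrtr_ge0 _)) -sqrtr_sqr.
  apply: ler_wsqrtr; apply: le_trans (gC _ zM) _; rewrite ler_wpM2r //.
  by rewrite Kinfty_le ?enorm_ge0 // le_max zM.
- move=> e e0; have [C C0 gC] := gain_bound 1.
  have eC : 0 < e ^+ 2 / (C + 1) by rewrite divr_gt0 ?exprn_gt0 // ltr_wpDl.
  have [d d0 ad] := Kinfty_small aK eC.
  exists (Num.min d 1) => [|z]; first by rewrite lt_min d0 ltr01.
  rewrite lt_min => /andP[zd z1].
  have := ad _ (enorm_ge0 _) zd; rewrite ltr_pdivlMr ?ltr_wpDl // => az.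
  rewrite -(@ltr_pXn2r _ 2) ?nnegrE ?sqrtr_ge0 // ?ltW //.
  apply: le_lt_trans (gC _ (ltW z1)) _; apply: le_lt_trans az.
  rewrite ler_wpM2l ?lerDl //.
  have [_ _ a0 _] := aK; by rewrite -a0 Kinfty_le ?enorm_ge0.
exists p, q; split=> // x d Dd dn0 xd.
pose z : S := exist _ (x, d) (conj Dd xd).
have sz : 0 < size z by rewrite /size /= enorm_gt0.
have [_ _ pP _ _] := pq; have [p0 _] := pP _ sz.
have := gp z sz; rewrite /gain /=.
have [h|h _] := leP 0 (2 * dot x (f x d) + enorm x ^+ 2).
  by move=> le; rewrite -(sqr_sqrtr h) lerXn2r // nnegrE ?sqrtr_ge0 // ltW.
by rewrite (le_trans (ltW h)) // sqr_ge0.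
Qed.
End gain.

Theorem theorem4 (R : realType) (n m : nat) (D : set 'rV[R]_m)
    (f : 'rV[R]_n -> 'rV[R]_m -> 'rV[R]_n) (alpha : R -> R)
    (hf : standing_assumptions D f)
    (hfb : bounded_on_bounded_sets D f)
    (halpha : class_Kinfty alpha)
    (hises : ISES D f 1 1 alpha) :
  exists h g : 'rV[R]_m -> 'rV[R]_m,
    [/\ homeomorphism_with_inverse h g,
        h 0 = 0,
        smooth_on [set x | x != 0] h /\ smooth_on [set x | x != 0] g
      & Hinfty_estimate (h @` D) (fun y v => f y (g v))].
Proof.
have [p [q [pq p_gain]]] := gain_dominated hfb halpha.
have [sp sq pP _ _] := pq.
exists (radial p), (radial q); split.
- exact: radial_homeomorphism.
- exact: radial0.
- by split; exact: smooth_on_radial.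
have [fwd _] := hises.
split.
  move=> x v /(admissible_radial pq) adm; exact: fwd x _ adm.
move=> x v T phi adm sol; apply: dissipation_L2_gain adm sol.
move=> y _ [d Dd <-]; rewrite (radial_can pq).
have N2 := sqr_ge0 (enorm (radial p d)).
have [yd|yd] := leP (enorm y) (alpha (enorm d)); last first.
  have fc d' : D d' -> continuous (fun y => f y d').
    exact: continuous_at_fixed_input hf.1.
  have := ISES_dissipation fc halpha hises Dd yd.
  by have := sqr_ge0 (enorm y); lra.
have [d0|d0] := eqVneq d 0; last first.
  have N0 : 0 < enorm d by rewrite enorm_gt0.
  rewrite enorm_radial //; last by have [/ltW] := pP _ N0.
  exact: p_gain.
have [_ _ a0 _] := halpha.
have -> : y = 0.
  by apply/eqP; move: yd; rewrite d0 enorm0 a0 leNgt enorm_gt0 negbK.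
by rewrite dot0l enorm0 expr0n /= mulr0 addr0.
Qed.
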